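(* Let $\mathcal{A}=\{A_1,\dots,A_p\}$ be a finite set of $n\times n$ nonnegative matrices which is positively-irreducible, and let $d\geq 0$ be an integer. Then $$r(T^d)\leq n^{1/(d+1)}\rho(\mathcal{A}).$$
   Context: $[p]=\{1,\dots,p\}$; $\mathbb{R}_+^n$ is the closed cone of vectors with nonnegative entries; suprema of vectors are taken entrywise. Joint spectral radius: $\rho(\mathcal{A})=\lim_{k\to\infty}\max_{1\leq i_1,\dots,i_k\leq p}\|A_{i_1}\cdots A_{i_k}\|^{1/k}$. The faces of $\mathbb{R}_+^n$ are the sets $\{x\in\mathbb{R}_+^n: x_i=0\text{ if }i\notin I\}$, $I\subseteq\{1,\dots,n\}$; those with $I=\emptyset$ and $I=\{1,\dots,n\}$ are trivial. A set of nonnegative matrices is positively-irreducible if no non-trivial face of $\mathbb{R}_+^n$ is left invariant by all matrices of the set. The operator $T^d$: let $\tau^d:[p]^d\times[p]\to[p]^d$ be $\tau^d(i_1\cdots i_d,a)=i_2\cdots i_d a$ (for $d=0$, $[p]^0$ consists only of the empty word and $\tau^0$ is constant). $T^d$ is the self-map of $\prod_{s\in[p]^d}\mathbb{R}_+^n$ sending $x=(x_s)_s$ to the vector with $s$-component $T^d_s(x)=\sup_{r\in[p]^d,\,a\in[p]:\ \tau^d(r,a)=s}A_a^T x_r$. In particular $T^0(x)=\sup_{1\leq a\leq p}A_a^Tx$. Spectral radius of a monotone ($x\leq y\Rightarrow f(x)\leq f(y)$), positively homogeneous ($f(\lambda x)=\lambda f(x)$ for $\lambda>0$) self-map $f$ of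 a cone $\mathcal{C}$: $r(f)=\lim_{k\to\infty}\|f^k(x)\|^{1/k}$ for $x\in\operatorname{int}\mathcal{C}$ (independent of the choice of $x$ and of the norm). *)

(* Defs.v *)
(* MathComp / MathComp-Analysis *)
From mathcomp Require Import all_boot all_order all_algebra.
From mathcomp Require Import all_classical all_reals all_analysis.
Import Order.TTheory GRing.Theory Num.Theory.
Import numFieldNormedType.Exports.

Set Implicit Arguments.
Unset Strict Implicit.
Unset Printing Implicit Defensive.

Local Open Scope classical_set_scope.
Local Open Scope ring_scope.

(* Norms are the library (max-entry) norms; the limit does not depend on this
   choice.  Norms being nonnegative, 0 is neutral for the maximum. *)
Definition joint_spectral_radius (R : realType) (n p : nat)
    (A : 'I_p -> 'M[R]_n) : R :=
  lim ((\big[Num.max/0]_(w : k.-tuple 'I_p)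
          `| \prod_(a <- w) A a | `^ (k%:R^-1)) @[k --> \oo]).

Definition orthant (R : realType) (m n : nat) : set 'M[R]_(m, n) :=
  [set x | forall i j, 0 <= x i j].

Definition orthant_face (R : realType) (n : nat) (I : set 'I_n) :
    set 'cV[R]_n :=
  [set x | orthant x /\ forall i, ~ I i -> x i 0 = 0].

Definition positively_irreducible (R : realType) (n p : nat)
    (A : 'I_p -> 'M[R]_n) : Prop :=
  ~ exists I : set 'I_n, [/\ I <> set0, I <> setT &
      forall a, (mulmx (A a)) @` (orthant_face I) `<=` orthant_face I].

(* For d = 0 the domain is reduced to the empty word. *)
Definition shift_word (p d : nat) (r : d.-tuple 'I_p) (a : 'I_p) :
    d.-tuple 'I_p :=
  [tuple of behead (rcons r a)].

(* A family of vectors indexed by the words of length d is stored as a matrix,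
   whose column of index enum_rank s is the component of index s; thus
   the product of the cones R_+^n is the orthant of such matrices.
   On the orthant, with nonnegative A, the entries below are nonnegative, so
   that the maximum with 0 is the supremum. *)
Definition lifted_operator (R : realType) (n p d : nat)
    (A : 'I_p -> 'M[R]_n) (x : 'M[R]_(n, #|{: d.-tuple 'I_p}|)) :
    'M[R]_(n, #|{: d.-tuple 'I_p}|) :=
  \matrix_(i, j) \big[Num.max/0]_(ra : d.-tuple 'I_p * 'I_p
                                  | shift_word ra.1 ra.2 == enum_val j)
    ((A ra.2)^T *m col (enum_rank ra.1) x) i 0.

(* The common value, for all x in the interior of C, of the limit. *)
Definition cone_spectral_radius (R : realType) (V : normedModType R)
    (C : set V) (f : V -> V) : R :=
  get [set r : R | forall x, C° x ->
         `| iter k f x | `^ (k%:R^-1) @[k --> \oo] --> r].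

(* Main.v *)
(* Fix l > rho(A).  The products of k matrices of A grow at most like l^k, so
   some c bounds (A_w^T x)_j / l^|w| over all words w and entries j, where x is
   the all-ones vector.  A bound c for x becomes c l^k for each A_u^T x with
   |u| = k, and hence, summing over the n entries, c n l^k for their supremum
   over u, because every entry of the supremum is attained by some A_u^T x and
   the bound is monotone on nonnegative vectors.  Since d+1 steps of T^d are
   dominated by the supremum over the words of length d+1, iterating gives
   r(T^d)^(d+1) <= n l^(d+1). *)
Require Import Defs.
From mathcomp Require Import all_boot all_order all_algebra.
From mathcomp Require Import ring lra.
From mathcomp Require Import all_classical all_reals all_analysis.
Import Order.TTheory GRing.Theory Num.Theory.
Import numFieldNormedType.Exports.
Local Open Scope classical_set_scope.
Local Open Scope ring_scope.

(** * Limits of k-th roots and exponential growth rates *)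

Lemma cvg_root_cst (R : realType) (c : R) : 0 < c ->
  c `^ (k%:R^-1) @[k --> \oo] --> (1 : R).
Proof.
move=> c0; rewrite (_ : (fun k => _) = (fun k : nat => expR (k%:R^-1 * ln c))).
  rewrite -[X in _ --> X]expR0.
  apply: continuous_cvg; first exact: continuous_expR.
  rewrite -[X in _ --> X](mul0r (ln c)); apply: cvgM; last exact: cvg_cst.
  have := @cvg_harmonic R.
  by rewrite (cvg_shiftS (fun k : nat => k%:R^-1 : R)); exact.
by apply/funext => k; rewrite /powR gt_eqF.
Qed.

Lemma powR_root (R : realType) (a : R) (k : nat) : 0 <= a -> (0 < k)%N ->
  (a ^+ k) `^ (k%:R^-1) = a.
Proof.
move=> a0 k0; rewrite -powR_mulrn// -powRrM mulfV ?powRr1//.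
by rewrite pnatr_eq0 -lt0n.
Qed.

Lemma root_exprn (R : realType) (a : R) (k : nat) : 0 <= a -> (0 < k)%N ->
  (a `^ (k%:R^-1)) ^+ k = a.
Proof.
move=> a0 k0; rewrite -powR_mulrn ?powR_ge0// -powRrM mulVf ?powRr1//.
by rewrite pnatr_eq0 -lt0n.
Qed.

Lemma ler_root (R : realType) (a b : R) (k : nat) : 0 <= a -> a <= b ->
  a `^ (k%:R^-1) <= b `^ (k%:R^-1).
Proof.
move=> a0 ab; apply: ge0_ler_powR => //; rewrite ?invr_ge0// nnegrE//.
exact: le_trans ab.
Qed.

(** The limit can be read along the multiples of [K], where the root of [C] tends to 1 and that of
    [mu ^+ m] is constant. *)
Lemma limit_root_le (R : realType) (u : nat -> R) (r C mu : R) (K : nat) :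
    (0 < K)%N -> 0 < C -> 0 <= mu -> (forall k, 0 <= u k) ->
    (forall m, u (m * K)%N <= C * mu ^+ m) ->
    u k `^ (k%:R^-1) @[k --> \oo] --> r ->
  r <= mu `^ (K%:R^-1).
Proof.
move=> K0 C0 mu0 u0 uC ur.
(* Starting at [m.+1] keeps the degree of the root positive. *)
pose f m := (m.+1 * K)%N.
have fK m : (m < f m)%N by rewrite /f -{1}[m.+1]muln1 leq_mul.
have foo : f m @[m --> \oo] --> \oo.
  move=> P [N _ NP]; exists N => // m /= Nm; apply: NP => /=.
  exact: leq_trans Nm (ltnW (fK m)).
have := cvg_comp _ _ foo ur => {}ur.
have := cvg_comp _ _ foo (@cvg_root_cst R C C0) => Cf.
have {}Cf : C `^ ((f m)%:R^-1) * mu `^ (K%:R^-1) @[m --> \oo]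
    --> mu `^ (K%:R^-1).
  by rewrite -[X in _ --> X]mul1r; apply: cvgM => //; exact: cvg_cst.
apply: ler_cvg_to ur Cf _.
apply: nearW => m /=; apply: le_trans (@ler_root _ _ _ (f m) (u0 _) (uC _)) _.
rewrite powRM ?exprn_ge0 ?(ltW C0)//.
have -> : (mu ^+ m.+1) `^ ((f m)%:R^-1) = mu `^ (K%:R^-1).
  by rewrite /f natrM invfM powRrM powR_root.
by [].
Qed.

(** A squeeze: the roots of both constants tend to 1. Half of [e] pays for [l = L + e / 2], the
    other half for the root of [C]. *)
Lemma cvg_root (R : realType) (u : nat -> R) (c L : R) :
    0 < c -> 0 <= L ->
    (forall k, (0 < k)%N -> c * L ^+ k <= u k) ->
    (forall l, L < l -> exists2 C, 0 < C & forall k, u k <= C * l ^+ k) ->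
  u k `^ (k%:R^-1) @[k --> \oo] --> L.
Proof.
move=> c0 L0 cu uC; apply/cvgrPdist_le => e e0.
have e2 : L < L + e / 2 by rewrite ltrDl divr_gt0.
have [C C0 uCk] := uC _ e2.
have lo : c `^ (k%:R^-1) * L @[k --> \oo] --> L.
  rewrite -[X in _ --> X]mul1r.
  by apply: cvgM; [exact: cvg_root_cst|exact: cvg_cst].
have hi : C `^ (k%:R^-1) * (L + e / 2) @[k --> \oo] --> L + e / 2.
  rewrite -[X in _ --> X]mul1r.
  by apply: cvgM; [exact: cvg_root_cst|exact: cvg_cst].
have le2 : 0 < e / 2 by rewrite divr_gt0.
near=> k.
have k0 : (0 < k)%N by near: k; exists 1%N.
have u0 : 0 <= u k.
  by apply: le_trans (cu k k0); rewrite mulr_ge0 ?exprn_ge0// ltW.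
have lok : c `^ (k%:R^-1) * L <= u k `^ (k%:R^-1).
  apply: le_trans (@ler_root _ _ _ k _ (cu k k0)); last first.
    by rewrite mulr_ge0 ?exprn_ge0// ltW.
  by rewrite powRM ?exprn_ge0 ?(ltW c0)// powR_root.
have L2 : 0 <= L + e / 2 by rewrite (le_trans L0)// ltW.
have hik : u k `^ (k%:R^-1) <= C `^ (k%:R^-1) * (L + e / 2).
  apply: le_trans (@ler_root _ _ _ k u0 (uCk k)) _.
  by rewrite powRM ?exprn_ge0 ?(ltW C0)// powR_root.
have Llo : L - c `^ (k%:R^-1) * L <= e.
  apply: le_trans (ler_norm _) _.
  by near: k; exact: (cvgrPdist_le _ _).1 lo _ e0.
have Lhi : C `^ (k%:R^-1) * (L + e / 2) - (L + e / 2) <= e / 2.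
  apply: le_trans (ler_norm _) _; rewrite distrC.
  by near: k; exact: (cvgrPdist_le _ _).1 hi _ le2.
rewrite ler_distl; lra.
Unshelve. all: by end_near. Qed.

(** Fekete's lemma: [L] is the infimum of the k-th roots of [b k] over positive [k]. *)
Lemma submultiplicative_root (R : realType) (b : nat -> R) :
    (forall k, 0 <= b k) -> (forall k m, b (k + m)%N <= b k * b m) ->
  exists L : R, [/\ 0 <= L, forall k, (0 < k)%N -> L ^+ k <= b k &
    forall l, L < l -> exists2 C, 0 < C & forall k, b k <= C * l ^+ k].
Proof.
move=> b0 bM.
pose B := [set b k `^ (k%:R^-1) | k in [set k | (0 < k)%N]].
have B0 : B !=set0 by exists (b 1%N `^ (1%:R^-1)); exists 1%N.
have Blb : lbound B 0 by move=> _ [k _ <-]; exact: powR_ge0.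
have infB : has_inf B by split=> //; exists 0.
have L0 : 0 <= inf B by exact: lb_le_inf.
exists (inf B); split => // [k k0|l Ll].
  rewrite -[leRHS](@root_exprn _ _ k)//.
  apply: lerXn2r; rewrite ?nnegrE ?powR_ge0//.
  by apply: ge_inf; [exists 0|exists k].
have l0 : 0 < l by exact: le_lt_trans Ll.
have [_ [m m0 <-] bml] := inf_lt B0 Ll.
have {}bml : b m <= l ^+ m.
  rewrite -[leLHS](@root_exprn _ _ m)//.
  by apply: lerXn2r; rewrite ?nnegrE ?powR_ge0 ?ltW.
(* Euclidean division by [m]: each block of length [m] costs a factor [l ^+ m]. *)
have bq q r : b (q * m + r)%N <= l ^+ (q * m) * b r.
  elim: q => [|q IHq]; first by rewrite mul0n expr0 mul1r.
  rewrite mulSn -addnA exprD -mulrA; apply: le_trans (bM _ _) _.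
  by apply: ler_pM.
(* The sum dominates [b r / l ^+ r] for every remainder [r < m]; the 1 makes the constant
   positive. *)
exists (1 + \sum_(i < m) b i / l ^+ i) => [|k].
  by rewrite ltr_wpDr// sumr_ge0// => i _; rewrite divr_ge0// exprn_ge0// ltW.
rewrite {1 2}(divn_eq k m); apply: le_trans (bq _ _) _.
have rm : (k %% m < m)%N by rewrite ltn_mod.
have brC : b (k %% m)%N <= (1 + \sum_(i < m) b i / l ^+ i) * l ^+ (k %% m).
  rewrite -ler_pdivrMr ?exprn_gt0// (bigD1 (Ordinal rm))//= addrCA lerDl.
  by rewrite addr_ge0// sumr_ge0// => i _; rewrite divr_ge0// exprn_ge0// ltW.
rewrite exprD mulrCA; apply: ler_wpM2l => //.
by rewrite exprn_ge0// ltW.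
Qed.

(** * The max-entry norm of matrices *)

Section MatrixNorm.
Variables (R : realType) (m n : nat).
Implicit Types x : 'M[R]_(m, n).

Lemma mx_norm_ub x i j : `|x i j| <= `|x|.
Proof. by rewrite {2}/Num.norm/= mx_normrE (le_bigmax _ _ (i, j)). Qed.

Lemma mx_norm_le x c : 0 <= c -> (forall i j, `|x i j| <= c) -> `|x| <= c.
Proof.
move=> c0 xc; rewrite /Num.norm/= mx_normrE.
by apply: bigmax_le => // -[i j] _; exact: xc.
Qed.

Lemma interior_orthant_const1 : (@orthant R m n)° (const_mx 1).
Proof.
apply/nbhs_ballP; exists 1 => //= y; rewrite mx_norm_ball /ball_/= => y1 i j.
have := le_lt_trans (mx_norm_ub _ i j) y1; rewrite !mxE ltr_distlC => /andP[].
by rewrite subrr => /ltW.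
Qed.

End MatrixNorm.

Lemma mx_norm_mul (R : realType) (m n q : nat) (A : 'M[R]_(m, n))
  (B : 'M[R]_(n, q)) : `|A *m B| <= n%:R * (`|A| * `|B|).
Proof.
apply: mx_norm_le => [|i j]; first by rewrite !mulr_ge0.
rewrite mxE; apply: le_trans (ler_norm_sum _ _ _) _.
rewrite -[n in n%:R]card_ord mulr_natl -sumr_const; apply: ler_sum => k _.
by rewrite normrM ler_pM// mx_norm_ub.
Qed.

(** * Growth of products along words *)

Section Words.
Variables (R : realType) (n p : nat) (A : 'I_p -> 'M[R]_n).
Hypothesis A_ge0 : forall a i j, 0 <= A a i j.

Definition word_prod (w : seq 'I_p) : 'M[R]_n := \prod_(a <- w) A a.

Definition max_norm (k : nat) : R :=
  \big[Num.max/0]_(w : k.-tuple 'I_p) `|word_prod w|.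

Lemma word_prod_cat u v : word_prod (u ++ v) = word_prod u *m word_prod v.
Proof. by rewrite /word_prod big_cat. Qed.

Lemma word_prod1 a : word_prod [:: a] = A a.
Proof. by rewrite /word_prod big_seq1. Qed.

Lemma word_prod_ge0 w i j : 0 <= word_prod w i j.
Proof.
elim: w i j => [|a w IHw] i j; first by rewrite /word_prod big_nil mxE ler0n.
rewrite -cat1s word_prod_cat mxE sumr_ge0// => k _.
by rewrite mulr_ge0// word_prod1.
Qed.

Lemma max_norm_ge0 k : 0 <= max_norm k.
Proof. exact: bigmax_ge_id. Qed.

Lemma word_prod_norm_le w : `|word_prod w| <= max_norm (size w).
Proof.
exact: (le_bigmax _ (fun u : (size w).-tuple 'I_p => `|word_prod u|)
  (in_tuple w)).
Qed.

Lemma max_norm_mul k m : max_norm (k + m) <= n%:R * (max_norm k * max_norm m).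
Proof.
apply: bigmax_le => [|w _]; first by rewrite !mulr_ge0// max_norm_ge0.
rewrite -(cat_take_drop k w) word_prod_cat.
apply: le_trans (mx_norm_mul _ _ _ _ _ _) _.
apply: ler_wpM2l => //; apply: ler_pM => //.
  apply: le_trans (word_prod_norm_le _) _.
  by rewrite size_takel// size_tuple leq_addr.
apply: le_trans (word_prod_norm_le _) _.
by rewrite size_drop size_tuple addKn.
Qed.

(** Roots are monotone, hence commute with the maximum. For [k = 0] the neutral element 0 would be
    sent to 1. *)
Lemma max_norm_root k : (0 < k)%N -> max_norm k `^ (k%:R^-1) =
  \big[Num.max/0]_(w : k.-tuple 'I_p) `|word_prod w| `^ (k%:R^-1).
Proof.
move=> k0.
pose rel (x y : R) := 0 <= x /\ x `^ (k%:R^-1) = y.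
suff [] : rel (max_norm k)
    (\big[Num.max/0]_(w : k.-tuple 'I_p) `|word_prod w| `^ (k%:R^-1)) by [].
apply: (@big_ind2 _ _ rel) => //.
  by split=> //; rewrite powR0// invr_eq0 pnatr_eq0 -lt0n.
move=> x _ y _ [x0 <-] [y0 <-]; split; first by rewrite le_max x0.
have [xy|yx] := leP x y; first by rewrite max_r// ler_root.
by rewrite max_l// ler_root// ltW.
Qed.

Lemma max_norm_growth : 0 <= joint_spectral_radius A /\
  forall l, joint_spectral_radius A < l ->
    exists2 C, 0 < C & forall k, n.+1%:R * max_norm k <= C * l ^+ k.
Proof.
(* The max-entry norm is submultiplicative up to a factor n only. *)
have n1 : 0 < n.+1%:R :> R by [].
have b0 k : 0 <= n.+1%:R * max_norm k by rewrite mulr_ge0 ?max_norm_ge0.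
have bM k m : n.+1%:R * max_norm (k + m)%N
    <= n.+1%:R * max_norm k * (n.+1%:R * max_norm m).
  rewrite -mulrA ler_wpM2l// mulrCA.
  apply: le_trans (max_norm_mul _ _) _.
  by rewrite ler_wpM2r ?mulr_ge0 ?max_norm_ge0// ler_nat.
have [L [L0 Lb Lg]] := submultiplicative_root _ _ b0 bM.
(* Weighting by [n.+1] instead of [n] keeps this lower constant positive when [n = 0]. *)
have : max_norm k `^ (k%:R^-1) @[k --> \oo] --> L.
  apply: (@cvg_root _ _ (n.+1%:R^-1)) => //.
    by move=> k k0; rewrite ler_pdivrMl// Lb.
  move=> l' /Lg[C C0 bC]; exists C => // k; apply: le_trans (bC k).
  by rewrite ler_peMl ?max_norm_ge0// ler1n.
move=> uL; have -> : joint_spectral_radius A = L.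
  apply: cvg_lim; first exact: norm_hausdorff.
  apply: cvg_trans uL; apply: near_eq_cvg.
  by exists 1%N => // k /= k0; exact: max_norm_root.
by [].
Qed.

(** * A growth bound over all words, and its behaviour under suprema *)

Definition orbit_bounded (l c : R) (x : 'cV[R]_n) :=
  forall w j, ((word_prod w)^T *m x) j 0 <= c * l ^+ size w.

Definition sup_op (k : nat) (x : 'cV[R]_n) : 'cV[R]_n :=
  \col_i \big[Num.max/0]_(w : k.-tuple 'I_p) ((word_prod w)^T *m x) i 0.

Lemma sup_op_ge0 k x i : 0 <= sup_op k x i 0.
Proof. by rewrite mxE bigmax_ge_id. Qed.

Lemma word_prod_sup_op_le w x i :
  ((word_prod w)^T *m x) i 0 <= sup_op (size w) x i 0.
Proof.
rewrite [leRHS]mxE.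
exact: (le_bigmax _ (fun u : (size w).-tuple 'I_p => ((word_prod u)^T *m x) i 0)
  (in_tuple w)).
Qed.

Lemma tr_word_prod_mul_ge0 w (x : 'cV[R]_n) i :
  (forall j, 0 <= x j 0) -> 0 <= ((word_prod w)^T *m x) i 0.
Proof.
move=> x0; rewrite mxE sumr_ge0// => j _.
by rewrite mulr_ge0// mxE word_prod_ge0.
Qed.

Lemma orbit_bounded_sup_op (l c : R) (x : 'cV[R]_n) (k : nat) :
  0 <= l -> 0 <= c -> (forall j, 0 <= x j 0) -> orbit_bounded l c x ->
  orbit_bounded l (c * (n%:R * l ^+ k)) (sup_op k x).
Proof.
move=> l0 c0 x0 xc w j; rewrite mxE.
have -> : c * (n%:R * l ^+ k) * l ^+ size w =
    \sum_(i < n) c * l ^+ (k + size w).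
  by rewrite sumr_const card_ord -mulr_natl exprD; ring.
apply: ler_sum => i _; rewrite [sup_op _ _ _ _]mxE.
apply: (@big_ind _ (fun y => (word_prod w)^T j i * y <= c * l ^+ (k + size w))).
- by rewrite mulr0 mulr_ge0// exprn_ge0.
- by move=> y z; case: (leP y z).
move=> u _.
(* Transposition reverses products, so the word is [u ++ w]; a single term of its nonnegative sum is
   at most the whole sum. *)
have := xc (u ++ w) j; rewrite size_cat size_tuple; apply: le_trans.
rewrite word_prod_cat trmx_mul -mulmxA [leRHS]mxE (bigD1 i)//= lerDl.
apply: sumr_ge0 => i' _; rewrite mulr_ge0 ?tr_word_prod_mul_ge0//.
by rewrite mxE word_prod_ge0.
Qed.

Lemma mulmx_word_prod_le a v w (x z : 'cV[R]_n) i :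
  (forall i, x i 0 <= ((word_prod w)^T *m z) i 0) -> v = rcons w a ->
  ((A a)^T *m x) i 0 <= ((word_prod v)^T *m z) i 0.
Proof.
move=> xz ->; rewrite -cats1 word_prod_cat trmx_mul word_prod1 -mulmxA.
rewrite mxE [leRHS]mxE; apply: ler_sum => k _.
by rewrite ler_wpM2l// mxE.
Qed.

(** * Comparison of the lifted operator with suprema over words *)

Section Lifted.
Variable d : nat.
Local Notation T := (@lifted_operator R n p d A).
Implicit Type x : 'M[R]_(n, #|{: d.-tuple 'I_p}|).

Lemma lifted_operator_ge0 x i j : 0 <= T x i j.
Proof. by rewrite mxE bigmax_ge_id. Qed.

(* The last t letters of s name the matrices applied in the t steps, while the
   suprema only range over letters shifted out of the index, on which the bound
   z does not depend. *)
Lemma iter_lifted_operator_le x (z : 'cV[R]_n) t (s : d.-tuple 'I_p) i :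
    (forall i, 0 <= z i 0) -> (forall i j, x i j <= z i 0) -> (t <= d)%N ->
  iter t T x i (enum_rank s) <= ((word_prod (drop (d - t) s))^T *m z) i 0.
Proof.
move=> z0 xz; elim: t s i => [|t IHt] s i td.
  by rewrite subn0 drop_oversize ?size_tuple// /word_prod big_nil trmx1 mul1mx.
rewrite iterS mxE enum_rankK; apply: bigmax_le => [|[r a] /= /eqP <-].
  exact: tr_word_prod_mul_ge0.
apply: (mulmx_word_prod_le a _ (drop (d - t) r)).
  by move=> i'; rewrite mxE; apply: IHt; exact: ltnW.
(* The last [t.+1] letters of the shifted word are the last [t] letters of [r] followed by [a]. *)
rewrite /= -drop1 drop_drop addn1 -subSn// subSS -drop_rcons//.
by rewrite size_tuple leq_subr.
Qed.

(** After [d] steps the index [r] spells all the matrices applied. One more step appends [a] and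
    forgets the first letter of [r], which the supremum over all words of length [d.+1] covers. *)
Lemma iter_lifted_operator_sup_op x (z : 'cV[R]_n) i j :
    (forall i, 0 <= z i 0) -> (forall i j, x i j <= z i 0) ->
  iter d.+1 T x i j <= sup_op d.+1 z i 0.
Proof.
move=> z0 xz; rewrite iterS mxE; apply: bigmax_le => [|[r a] /= _].
  exact: sup_op_ge0.
have sz : size (rcons r a) = d.+1 by rewrite size_rcons size_tuple.
rewrite -[in leRHS]sz; apply: le_trans (word_prod_sup_op_le _ _ _).
apply: (mulmx_word_prod_le a _ r) => // i'; rewrite mxE.
have := iter_lifted_operator_le x z d r i' z0 xz (leqnn d).
by rewrite subnn drop0.
Qed.

Lemma norm_iter_lifted_operator_le (l c : R) (m : nat) :
    0 <= l -> 0 <= c -> orbit_bounded l c (const_mx 1) ->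
  `|iter (m * d.+1) T (const_mx 1)| <= c * (n%:R * l ^+ d.+1) ^+ m.
Proof.
move=> l0 c0 lc.
(* One vector [z] dominates all columns at once, so that the comparison can be iterated without
   tracking indices. *)
have [z [z0 zx zc]] : exists z : 'cV[R]_n, [/\ forall i, 0 <= z i 0,
    forall i j, iter (m * d.+1) T (const_mx 1) i j <= z i 0 &
    orbit_bounded l (c * (n%:R * l ^+ d.+1) ^+ m) z].
  elim: m => [|m [z [z0 zx zc]]].
    exists (const_mx 1); split=> [i|i j|]; rewrite ?mxE//.
    by rewrite expr0 mulr1.
  exists (sup_op d.+1 z); split=> [i|i j|]; first exact: sup_op_ge0.
    by rewrite mulSn iterD; exact: iter_lifted_operator_sup_op.
  rewrite exprSr mulrA; apply: orbit_bounded_sup_op => //.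
  by rewrite mulr_ge0// exprn_ge0// mulr_ge0// exprn_ge0.
apply: mx_norm_le => [|i j].
  by rewrite mulr_ge0// exprn_ge0// mulr_ge0// exprn_ge0.
rewrite ger0_norm; last first.
  by case: (m * d.+1)%N => [|k]; [rewrite mxE|exact: lifted_operator_ge0].
apply: le_trans (zx i j) _.
(* The empty word turns the orbit bound into a bound on [z] itself. *)
have := zc [::] i; rewrite /word_prod big_nil trmx1 mul1mx.
by rewrite expr0 mulr1.
Qed.

End Lifted.
End Words.

Theorem theorem7 (R : realType) (n p d : nat) (A : 'I_p -> 'M[R]_n)
    (p_gt0 : (0 < p)%N)
    (A_ge0 : forall a i j, 0 <= A a i j)
    (A_irr : positively_irreducible A) :
  cone_spectral_radius
    (@orthant R n #|{: d.-tuple 'I_p}|) (@lifted_operator R n p d A)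
  <= n%:R `^ (d.+1%:R^-1) * joint_spectral_radius A.
Proof.
have [rho0 rhoC] := max_norm_growth _ _ _ A.
rewrite /cone_spectral_radius.
set S := (X in get X).
(* [get] of an empty set is the default point, which is 0 in R. *)
have [[r Sr]|S0] := pselect (exists r, S r); last first.
  rewrite getPN; first by rewrite mulr_ge0// powR_ge0.
  by move=> r Sr; apply: S0; exists r.
have := getPex (ex_intro _ r Sr); set r' := get S => r1.
have {r1}cvg_r := r1 _ (interior_orthant_const1 _ _ _).
have bnd l : joint_spectral_radius A < l -> r' <= n%:R `^ (d.+1%:R^-1) * l.
  move=> rl; have [C C0 MC] := rhoC l rl.
  have l0 : 0 <= l by rewrite (le_trans rho0)// ltW.
  (* Writing [l] as a root of [l ^+ d.+1] makes the right-hand side the root of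
     [n%:R * l ^+ d.+1]. *)
  rewrite -[l in leRHS](@powR_root _ _ d.+1)// -powRM ?exprn_ge0//.
  apply: (@limit_root_le _ _ _ C) cvg_r => // [|m].
    by rewrite mulr_ge0// exprn_ge0.
  apply: norm_iter_lifted_operator_le => //; first exact: ltW.
  (* Applied to the all-ones vector, the transpose gives a column sum of [n] entries, each at most
     the norm. *)
  move=> w j; apply: le_trans (MC _); rewrite mxE.
  apply: (@le_trans _ _ (n%:R * max_norm _ _ _ A (size w))); last first.
    by rewrite ler_wpM2r ?max_norm_ge0// ler_nat.
  rewrite -[n in n%:R]card_ord mulr_natl -sumr_const; apply: ler_sum => k _.
  rewrite !mxE mulr1; apply: le_trans (ler_norm _) _.
  by apply: le_trans (mx_norm_ub _ _ _ _ _ _) _; exact: word_prod_norm_le.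
set q := n%:R `^ _ in bnd *.
have q0 : 0 <= q by exact: powR_ge0.
apply/ler_addgt0Pr => e e0.
(* Dividing [e] by [q + 1] keeps the excess [q * (e / (q + 1))] below [e] and also covers
   [q = 0]. *)
have q1 : 0 < q + 1 by rewrite ltr_wpDl.
apply: le_trans (bnd (joint_spectral_radius A + e / (q + 1)) _) _.
  by rewrite ltrDl divr_gt0.
by rewrite mulrDr lerD2l mulrA ler_pdivrMr// mulrC ler_pM2l// lerDl.
Qed.
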